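(* There exists an online algorithm for the Matroid Prophet Secretary problem (defined in the context) whose expected total value of selected elements is at least $(1-1/e)\cdot \mathbb{E}\big[\max_{I\in\mathcal{I}}\sum_{i\in I} v_i\big]$.
   Context: Matroid Prophet Secretary problem: a matroid $\mathcal{M}=([n],\mathcal{I})$ is given. Element (buyer) $i\in[n]$ has a nonnegative random value $v_i$ drawn from a known distribution, the $v_i$ being mutually independent. The elements arrive in a uniformly random order (equivalently, each element $i$ arrives at an independent time $T_i$ uniform on $[0,1]$, independent of the values, and elements are processed in increasing order of arrival time). When element $i$ arrives its value $v_i$ is revealed and the algorithm must immediately and irrevocably decide whether to select $i$; the set of selected elements must be independent in $\mathcal{M}$ at all times. The expectation of the algorithm's value is over the values, the arrival order and the algorithm's internal randomness. *)

(* Defs.v *)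
From HB Require Import structures.
From mathcomp Require Import all_boot all_order all_algebra.
From mathcomp Require Import all_classical all_reals all_analysis.
Set Implicit Arguments. Unset Strict Implicit. Unset Printing Implicit Defensive.
Import Order.TTheory GRing.Theory Num.Theory.
Local Open Scope classical_set_scope.
Local Open Scope ring_scope.

Record matroid (n : nat) := Matroid {
  indep : {set 'I_n} -> bool;
  indep0 : indep finset.set0;
  indep_sub : forall A B : {set 'I_n}, A \subset B -> indep B -> indep A;
  indep_exchange : forall A B : {set 'I_n}, indep A -> indep B -> (#|A| < #|B|)%N ->
      exists2 x, x \in B :\: A & indep (x |: A)
}.

Definition mutually_independent d (Omega : measurableType d) (R : realType)
    (P : probability Omega R) (I : finType) (X : I -> Omega -> R) : Prop :=
  forall B : I -> set R, (forall i, measurable (B i)) ->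
    P (\bigcap_(i in [set: I]) (X i @^-1` B i)) = (\prod_(i : I) P (X i @^-1` B i))%E.

(** The family of all the random variables of the model: values v_i,
    arrival times T_i, and the algorithm's random seed xi. *)
Definition all_rvs d (Omega : measurableType d) (R : realType) (n : nat)
    (v T : 'I_n -> Omega -> R) (xi : Omega -> R) : ('I_n + 'I_n) + unit -> Omega -> R :=
  fun j => match j with
           | inl (inl i) => v i
           | inl (inr i) => T i
           | inr _ => xi
           end.

(** * Online algorithms.
    A history entry is (element, arrival time, value).  An online algorithm is
    a decision rule: given the history of previously arrived elements (in order
    of arrival, with their arrival times and values), the current element, its
    arrival time, its value, and the algorithm's random seed, it decides whether
    to select the current element.  (Its own past decisions are determined by
    these data, so they need not be passed explicitly.) *)
Definition history (R : realType) (n : nat) := seq ('I_n * R * R).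
Definition online_alg (R : realType) (n : nat) :=
  history R n -> 'I_n -> R -> R -> R -> bool.

(** Arrival order: increasing arrival time (ties, a null event, broken by index). *)
Definition arrival_order (R : realType) (n : nat) (t : 'I_n -> R) : seq 'I_n :=
  sort (fun i j => (t i < t j) || ((t i == t j) && (i <= j)%N)) (enum 'I_n).

(** One step of the online process; the state is (history, selected set).
    An element is selected iff the algorithm accepts it and the selected set
    stays independent (an attempt to select infeasibly is ignored, which is
    without loss of generality since the algorithm can check feasibility). *)
Definition online_step (R : realType) (n : nat) (M : matroid n) (alg : online_alg R n)
    (t x : 'I_n -> R) (u : R) (st : history R n * {set 'I_n}) (e : 'I_n)
    : history R n * {set 'I_n} :=
  let: (h, Sel) := st in
  let S' := if alg h e (t e) (x e) u && indep M (e |: Sel) then e |: Sel else Sel in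
  (rcons h (e, t e, x e), S').

Definition selected (R : realType) (n : nat) (M : matroid n) (alg : online_alg R n)
    (t x : 'I_n -> R) (u : R) : {set 'I_n} :=
  (foldl (online_step M alg t x u) ([::], finset.set0) (arrival_order t)).2.

Definition alg_value (R : realType) (n : nat) (M : matroid n) (alg : online_alg R n)
    (t x : 'I_n -> R) (u : R) : R :=
  \sum_(i in selected M alg t x u) x i.

Definition opt_value (R : realType) (n : nat) (M : matroid n) (x : 'I_n -> R) : R :=
  \big[Order.max/0]_(I : {set 'I_n} | indep M I) \sum_(i in I) x i.

(* Main.v *)
(** For a set [A] of selected elements let [residual A] be the expected optimum, for
    fresh values, of the matroid contracted by [A], and let the price of [i] be
    [residual A - residual (i |: A)].  An element [i] arriving at time [t] with [A]
    selected is accepted iff [A] can be extended by it and its value is at least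
    [1 - exp (t - 1)] times its price.

    Symmetric exchange makes prices increase with [A], so the prices at [A] of an
    independent set of the contraction sum to at most [residual A].  Write [A_s] for
    the set selected by time [s].
    - Revenue.  Since [1 - exp (t - 1)] is the integral of [exp (s - 1)] over [t, 1],
      the prices telescope and the expected revenue is the integral over [0, 1] of
      [exp (s - 1) * E (residual empty - residual A_s)].
    - Utility.  An element not in [A_s] has not influenced [A_s], so if [i] arrives at
      [s] it meets a set no larger than [A_s]; hence the expected utility is at least
      the integral of the surplus offered by [A_s] to fresh values, which is at least
      [exp (s - 1) * E (residual A_s)].
    The sum is [(1 - 1/e) * residual empty].  The integrals over [s] are expectations
    over the uniform seed of the algorithm, which the algorithm itself never reads. *)
Require Import Defs.
From HB Require Import structures.
From mathcomp Require Import all_boot all_order all_algebra.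
From mathcomp Require Import all_classical all_reals all_analysis.
From mathcomp Require Import measurable_realfun lra.
Set Implicit Arguments. Unset Strict Implicit. Unset Printing Implicit Defensive.
Import Order.TTheory GRing.Theory Num.Theory.
Import numFieldNormedType.Exports.
Local Open Scope ring_scope.

Local Notation fset0 := finset.set0.

(** * Matroid exchange and contracted optima *)

Section matroid_exchange.
Variables (n : nat) (M : matroid n).
Implicit Types A B C I V K S U : {set 'I_n}.

Lemma indep_augment A B : indep M A -> indep M B ->
  exists K, [/\ A \subset K, K \subset A :|: B, indep M K & (#|B| <= #|K|)%N].
Proof.
(* Induction on the deficit of [A]; each exchange lowers it by one. *)
move: {2}(#|B| - #|A|)%N (leqnn (#|B| - #|A|)) => m.
elim: m A => [|m IH] A le iA iB.
  by exists A; split=> //; [exact: finset.subsetUl|rewrite -subn_eq0 -leqn0].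
have [ltAB|leBA] := ltnP #|A| #|B|; last first.
  by exists A; split=> //; exact: finset.subsetUl.
have [x /finset.setDP[xB xA] ixA] := indep_exchange iA iB ltAB.
have [|K [sK Ks iK cK]] := IH (x |: A) _ ixA iB.
  by rewrite cardsU1 xA add1n subnS -ltnS prednK ?subn_gt0 //; exact: leq_trans le _.
exists K; split=> //.
- by apply: fintype.subset_trans sK; exact: finset.subsetUr.
- apply: (fintype.subset_trans Ks); apply/fintype.subsetP => y.
  rewrite !inE => /orP[/orP[/eqP->|->]|->] //; rewrite ?xB ?orbT //.
Qed.

(* Any [x] of the fundamental circuit of [i] over [V] not spanned by [I :\ i] works. *)
Lemma indep_symmetric_exchange I V i :
  indep M I -> indep M V -> i \in I -> ~~ indep M (i |: V) ->
  exists x, [/\ x \in V, x \notin I, indep M (i |: (V :\ x)) & indep M (x |: (I :\ i))].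
Proof.
move=> iI iV inI niV.
(* For a minimal such [C], the set [i |: C] is the fundamental circuit of [i]. *)
pose P C := (C \subset V) && ~~ indep M (i |: C).
have [C minC _] : {C | minset P C & C \subset V}.
  by apply: minset_exists; rewrite /P fintype.subxx.
have /andP[CV niC] := minsetp minC.
have iC : indep M C := indep_sub CV iV.
have inV : i \notin V by apply: contra niV => iV'; rewrite (finset.setUidPr _) ?finset.sub1set.
set J := I :\ i.
have iJ : indep M J by apply: indep_sub iI; exact: finset.subsetDl.
have cJ : #|I| = #|J|.+1 by rewrite (cardsD1 i) inI.
(* A maximal independent [K] between [C] and [C :|: J] is larger than [J]: otherwise [I] augments
   [K], by [i] against [niC] or by an element of [J] against maximality. So [K] augments [J],
   necessarily by an element of [C]. *)
have [x [xC xJ ixJ]] : exists x, [/\ x \in C, x \notin J & indep M (x |: J)].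
  pose PK K := indep M K && (K \subset C :|: J).
  have [K maxK CK] : {K | maxset PK K & C \subset K}.
    by apply: maxset_exists; rewrite /PK iC finset.subsetUl.
  have /andP[iK KCJ] := maxsetp maxK.
  have [ltJK|leKJ] := ltnP #|J| #|K|.
    have [x /finset.setDP[xK xJ] ix] := indep_exchange iJ iK ltJK.
    exists x; split=> //.
    by have := fintype.subsetP KCJ _ xK; rewrite finset.inE (negbTE xJ) orbF.
  have ltKI : (#|K| < #|I|)%N by rewrite cJ ltnS.
  have [y /finset.setDP[yI yK] iy] := indep_exchange iK iI ltKI.
  have [yi|yi] := eqVneq y i.
    move: niC; rewrite (indep_sub _ iy) // yi.
    exact: finset.setUS.
  have PyK : PK (y |: K).
    rewrite /PK iy /=; apply/fintype.subsetP => z; rewrite !finset.inE => /orP[/eqP->|zK].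
      by rewrite yi yI orbT.
    by have := fintype.subsetP KCJ _ zK; rewrite !finset.inE.
  have := maxsetsup maxK PyK (finset.subsetUr _ _) => e.
  by move: yK; rewrite -e !finset.inE eqxx.
have xV : x \in V := fintype.subsetP CV _ xC.
have xi : x != i by apply: contraNneq inV => <-.
exists x; split=> //; first by move: xJ; rewrite !finset.inE xi.
have iCx : indep M (i |: (C :\ x)).
  apply: contraT => niCx.
  have PCx : P (C :\ x).
    rewrite /P niCx andbT; apply: fintype.subset_trans CV; exact: finset.subsetDl.
  have e := minsetinf minC PCx (finset.subsetDl _ _).
  by move: xC; rewrite -e !finset.inE eqxx.
(* Augmenting [i |: (C :\ x)] from [V] cannot restore [x], which would complete the circuit; by
   cardinality only [i |: (V :\ x)] remains. *)
have [D [sD Ds iD cD]] := indep_augment iCx iV.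
have xD : x \notin D.
  apply/negP => xD; move: niC; rewrite (indep_sub _ iD) //.
  apply/fintype.subsetP => z; rewrite !finset.inE => /orP[/eqP->|zC].
    by apply: (fintype.subsetP sD); rewrite !finset.inE eqxx.
  have [->//|zx] := eqVneq z x.
  by apply: (fintype.subsetP sD); rewrite !finset.inE zx zC orbT.
suff <- : D = i |: (V :\ x) by [].
apply/eqP; rewrite eqEcard; apply/andP; split.
  apply/fintype.subsetP => z zD; have zx : z != x by apply: contraNneq xD => <-.
  have := fintype.subsetP Ds _ zD; rewrite !finset.inE zx /=.
  by case/orP=> [/orP[->//|zC]|->]; rewrite ?(fintype.subsetP CV _ zC) orbT.
rewrite cardsU1 !finset.inE (negbTE inV) andbF /= add1n.
by move: cD; rewrite (cardsD1 x V) xV add1n.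
Qed.

End matroid_exchange.

Section contracted_optimum.
Variables (R : realType) (n : nat) (M : matroid n).
Implicit Types (A S U V : {set 'I_n}) (x : 'I_n -> R).

(** For a dependent [A] no [S] qualifies and the value is the default 0; for an independent [A] the
    empty [S] already gives 0. *)
Definition contracted_opt A x : R :=
  \big[Order.max/0]_(S : {set 'I_n} | [disjoint A & S] && indep M (A :|: S))
    \sum_(i in S) x i.

Lemma contracted_opt0 x : contracted_opt fset0 x = opt_value M x.
Proof.
rewrite /contracted_opt /opt_value; apply: eq_bigl => S.
by rewrite finset.set0U -setI_eq0 finset.set0I eqxx.
Qed.

Lemma contracted_opt_ge0 A x : 0 <= contracted_opt A x.
Proof. exact: bigmax_ge_id. Qed.

Lemma contracted_opt_ub A S x : [disjoint A & S] -> indep M (A :|: S) ->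
  \sum_(i in S) x i <= contracted_opt A x.
Proof.
move=> dAS iAS.
by apply: (@le_bigmax_cond _ _ _ _ S _ (fun S : {set 'I_n} => \sum_(i in S) x i)); rewrite dAS.
Qed.

Lemma contracted_opt_attained A x : indep M A ->
  exists S, [/\ [disjoint A & S], indep M (A :|: S)
              & contracted_opt A x = \sum_(i in S) x i].
Proof.
move=> iA; rewrite /contracted_opt.
elim/big_ind : _ => [|a b [S [dS iS ->]] [U [dU iU ->]]|S /andP[dS iS]].
- by exists fset0; rewrite -setI_eq0 finset.setI0 finset.setU0 big_set0.
- by rewrite maxEle; case: ifP => _; [exists U|exists S].
- by exists S.
Qed.

Lemma contracted_opt_dependent A x : ~~ indep M A -> contracted_opt A x = 0.
Proof.
move=> nA; rewrite /contracted_opt big_pred0 // => S.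
apply/negbTE; rewrite negb_and; apply/orP; right; apply: contra nA.
by apply: indep_sub; exact: finset.subsetUl.
Qed.

Lemma contracted_opt_decr A i x : i \notin A ->
  contracted_opt (i |: A) x <= contracted_opt A x.
Proof.
move=> iA; have [ind|nind] := boolP (indep M (i |: A)); last first.
  by rewrite contracted_opt_dependent //; exact: contracted_opt_ge0.
have [S [dS iS ->]] := contracted_opt_attained x ind.
apply: contracted_opt_ub.
- by apply: disjointWl dS; exact: finset.subsetUr.
- by apply: indep_sub iS; apply: finset.setSU; exact: finset.subsetUr.
Qed.

(** Optimal sets [V] for [A] and [U] for [i |: (j |: A)] are redistributed. If [i] is in [V], it
    moves to [U]: [V :\ i] serves [i |: A] and [i |: U] serves [j |: A]; likewise for [j]. If [i]
    extends [A :|: V], nothing moves. Otherwise symmetric exchange trades [i] for some [y] of [V],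
    and [y] moves to [U]. *)
Lemma contracted_opt_supermodular A i j x : i != j -> i \notin A -> j \notin A ->
  indep M (i |: (j |: A)) ->
  contracted_opt A x + contracted_opt (i |: (j |: A)) x
    <= contracted_opt (i |: A) x + contracted_opt (j |: A) x.
Proof.
move=> ij iA jA ind.
have indA : indep M A.
  by apply: indep_sub ind; apply/fintype.subsetP => y yA; rewrite !finset.inE yA !orbT.
have [V [dV iV ->]] := contracted_opt_attained x indA.
have [U [dU iU ->]] := contracted_opt_attained x ind.
have dVA y : y \in A -> y \in V = false by move=> yA; exact: (disjointFr dV).
have dUA y : y \in A -> y \in U = false.
  by move=> yA; apply: (disjointFr dU); rewrite !finset.inE yA !orbT.
have iU' : i \in U = false by apply: (disjointFr dU); rewrite !finset.inE eqxx.
have jU' : j \in U = false by apply: (disjointFr dU); rewrite !finset.inE eqxx orbT.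
have disjP (B C : {set 'I_n}) : (forall y, y \in B -> y \in C -> False) -> [disjoint B & C].
  move=> h; rewrite -setI_eq0; apply/eqP/setP => y; rewrite !finset.inE.
  by apply/negP => /andP[/h].
have ub (B S B' : {set 'I_n}) : indep M B' -> {subset B :|: S <= B'} ->
    (forall y, y \in B -> y \in S -> False) -> \sum_(k in S) x k <= contracted_opt B x.
  move=> iB' sub h; apply: contracted_opt_ub; first exact: disjP.
  by apply: indep_sub iB'; exact/fintype.subsetP.
have [iVi|iVi] := boolP (i \in V).
  rewrite (big_setD1 i iVi) /= -addrA [in leLHS]addrCA; apply: lerD.
    apply: (ub _ _ _ iV) => y; rewrite !finset.inE.
      by move=> /orP[/orP[/eqP->|->]|/andP[_ ->]]; rewrite ?iVi ?orbT.
    by move=> /orP[/eqP->|/dVA->]; rewrite ?eqxx ?andbF.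
  rewrite -[leLHS](big_setU1 _ (negbT iU')) /=.
  apply: (ub _ _ _ iU) => y; rewrite !finset.inE.
    by move=> /orP[/orP[->|->]|/orP[->|->]]; rewrite ?orbT.
  move=> /orP[/eqP->|yA] /orP[/eqP yi|yU].
  + by rewrite yi eqxx in ij.
  + by rewrite yU in jU'.
  + by rewrite -yi yA in iA.
  + by rewrite dUA in yU.
have [jVj|jVj] := boolP (j \in V).
  rewrite (big_setD1 j jVj) /= -addrA [in leLHS]addrCA [leRHS]addrC; apply: lerD.
    apply: (ub _ _ _ iV) => y; rewrite !finset.inE.
      by move=> /orP[/orP[/eqP->|->]|/andP[_ ->]]; rewrite ?jVj ?orbT.
    by move=> /orP[/eqP->|/dVA->]; rewrite ?eqxx ?andbF.
  rewrite -[leLHS](big_setU1 _ (negbT jU')) /=.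
  apply: (ub _ _ _ iU) => y; rewrite !finset.inE.
    by move=> /orP[/orP[->|->]|/orP[->|->]]; rewrite ?orbT.
  move=> /orP[/eqP->|yA] /orP[/eqP yi|yU].
  + by rewrite yi eqxx in ij.
  + by rewrite yU in iU'.
  + by rewrite -yi yA in jA.
  + by rewrite dUA in yU.
have [iV'|niV'] := boolP (indep M (i |: (A :|: V))).
  apply: lerD.
    apply: (ub _ _ _ iV') => y; rewrite !finset.inE.
      by move=> /orP[/orP[->|->]|->]; rewrite ?orbT.
    by move=> /orP[/eqP->|/dVA->] //; apply/negP.
  apply: (ub _ _ _ iU) => y; rewrite !finset.inE.
    by move=> /orP[/orP[->|->]|->]; rewrite ?orbT.
  by move=> /orP[/eqP->|/dUA->]; rewrite ?jU'.
have iI : i \in (i |: (j |: A)) :|: U by rewrite !finset.inE eqxx.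
have [y [yV yI iy1 iy2]] := indep_symmetric_exchange iU iV iI niV'.
move: yI; rewrite !finset.inE !negb_or => /andP[/and3P[yi yj yA] yU].
have {}yV : y \in V by move: yV; rewrite finset.inE (negbTE yA).
rewrite (big_setD1 y yV) /= -addrA [in leLHS]addrCA; apply: lerD.
  apply: (ub _ _ _ iy1) => z; rewrite !finset.inE.
    move=> /orP[/orP[->//|zA]|/andP[-> ->]]; rewrite ?orbT //.
    by rewrite zA andbT; apply/orP; right; apply: contraNneq yA => <-.
  by move=> /orP[/eqP->|/dVA->]; rewrite ?(negbTE iVi) ?andbF.
rewrite -[leLHS](big_setU1 _ yU) /=.
apply: (ub _ _ _ iy2) => z; rewrite !finset.inE.
  case: (eqVneq z y) => [//|zy] /=.
  move=> /orP[/orP[/eqP->|zA]|zU].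
  + by rewrite eqxx eq_sym ij orbT.
  + by rewrite zA !orbT andbT; apply: contraNneq iA => <-.
  + by rewrite zU !orbT andbT; apply: contraFneq iU' => <-.
move=> /orP[/eqP->|zA] /orP[/eqP e|zU].
+ by rewrite e eqxx in yj.
+ by rewrite zU in jU'.
+ by rewrite -e zA in yA.
+ by rewrite dUA in zU.
Qed.

End contracted_optimum.

(** * Prices and the online process *)

Section prices.
Variables (R : realType) (n : nat) (M : matroid n) (Rv : {set 'I_n} -> R).
Implicit Types A B S : {set 'I_n}.

Definition price A i : R := Rv A - Rv (i |: A).

Hypothesis Rv_ge0 : forall A, 0 <= Rv A.
Hypothesis Rv_supermodular : forall A i j, i != j -> i \notin A -> j \notin A ->
  indep M (i |: (j |: A)) -> Rv A + Rv (i |: (j |: A)) <= Rv (i |: A) + Rv (j |: A).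

(** The elements of [B :\: A] are removed one at a time, each removal being one instance of
    [Rv_supermodular]. *)
Lemma price_mono A B i : A \subset B -> i \notin B -> indep M (i |: B) ->
  price A i <= price B i.
Proof.
move: {2}#|B :\: A| (erefl #|B :\: A|) => m.
elim: m B => [|m IH] B cB AB iB indB.
  suff -> : A = B by [].
  by apply/eqP; rewrite finset.eqEsubset AB -finset.setD_eq0 -cards_eq0 cB.
have /card_gt0P[j] : (0 < #|B :\: A|)%N by rewrite cB.
rewrite !finset.inE => /andP[jA jB].
have BE : B = j |: (B :\ j) by rewrite finset.setD1K.
have ij : i != j by apply: contraNneq iB => ->.
have sBj : B :\ j \subset B := finset.subD1set _ _.
have ABj : A \subset B :\ j by rewrite finset.subsetD1 AB.
apply: (@le_trans _ _ (price (B :\ j) i)).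
  apply: IH => //.
  - apply/eqP; rewrite -eqSS -cB (cardsD1 j (B :\: A)) !finset.inE jA jB add1n eqSS.
    apply/eqP; apply: eq_card => k; rewrite !finset.inE.
    by case: (k == j); case: (k \in A); case: (k \in B).
  - by rewrite !finset.inE (negbTE iB) andbF.
  - by apply: indep_sub indB; exact: finset.setUS.
have /Rv_supermodular : i != j := ij.
move=> /(_ (B :\ j)); rewrite -BE !finset.inE (negbTE iB) eqxx andbF.
by move=> /(_ isT isT indB); rewrite /price; lra.
Qed.

(** Adding the elements of [S] to [A] one by one telescopes to [Rv A - Rv (A :|: S)], and by
    [price_mono] each is priced on the way at least as high as at [A]. *)
Lemma price_sum A S : [disjoint A & S] -> indep M (A :|: S) ->
  \sum_(i in S) price A i <= Rv A.
Proof.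
suff H : [disjoint A & S] -> indep M (A :|: S) ->
    \sum_(i in S) price A i <= Rv A - Rv (A :|: S).
  by move=> dAS iAS; have := H dAS iAS; have := Rv_ge0 (A :|: S); lra.
move: {2}#|S| (erefl #|S|) => m.
elim: m S => [|m IH] S cS dAS iAS.
  by move/eqP: cS; rewrite cards_eq0 => /eqP ->; rewrite big_set0 finset.setU0 subrr.
have /card_gt0P[j jS] : (0 < #|S|)%N by rewrite cS.
have jA : j \in A = false by exact: (disjointFl dAS).
rewrite (big_setD1 j jS) /=.
have cSj : #|S :\ j| = m by apply/eqP; rewrite -eqSS -cS (cardsD1 j S) jS add1n.
have dj : [disjoint A & S :\ j] by apply: disjointWr dAS; exact: finset.subD1set.
have SE : j |: (A :|: S :\ j) = A :|: S.
  by rewrite finset.setUCA finset.setD1K.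
have ij : indep M (A :|: S :\ j).
  by apply: indep_sub iAS; apply: finset.setUS; exact: finset.subD1set.
have := IH _ cSj dj ij.
have : price A j <= price (A :|: S :\ j) j.
  apply: price_mono; first exact: finset.subsetUl.
  - by rewrite !finset.inE jA eqxx.
  - by rewrite SE.
by rewrite {2}/price SE; lra.
Qed.

End prices.

(** * Greedy runs along an arrival order *)

Section greedy_selection.
Variable n : nat.
Implicit Types (A : {set 'I_n}) (l : seq 'I_n) (acc : {set 'I_n} -> 'I_n -> bool).

(** Times and values are frozen into [acc], so that a run depends on its past only through the
    selected set. *)
Definition greedy acc A l : {set 'I_n} :=
  foldl (fun A e => if acc A e then e |: A else A) A l.

Lemma greedy_cat acc A l1 l2 :
  greedy acc A (l1 ++ l2) = greedy acc (greedy acc A l1) l2.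
Proof. by rewrite /greedy foldl_cat. Qed.

Lemma greedy_sub acc A l : A \subset greedy acc A l.
Proof.
elim: l A => [|e l IH] A //=; apply: fintype.subset_trans (IH _).
by case: ifP => // _; exact: finset.subsetUr.
Qed.

Lemma greedy_mem acc A l i : i \in greedy acc A l -> (i \in A) || (i \in l).
Proof.
elim: l A => [|e l IH] A /=; first by move=> ->.
move=> /IH; rewrite in_cons; case: ifP => _; rewrite ?finset.inE.
  by case: (i == e); case: (i \in A); case: (i \in l).
by case: (i == e); case: (i \in A); case: (i \in l).
Qed.

(** Elements never leave and [i] arrives only once, so its membership is decided on arrival. *)
Lemma greedy_split acc l1 l2 i : uniq (l1 ++ i :: l2) ->
  (i \in greedy acc fset0 (l1 ++ i :: l2)) = acc (greedy acc fset0 l1) i.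
Proof.
rewrite cat_uniq /= => /and4P[_ /norP[il1 _] il2 _].
rewrite greedy_cat /=; case: ifP => _.
  by apply: (fintype.subsetP (greedy_sub _ _ _)); rewrite !finset.inE eqxx.
apply/negP => /greedy_mem; rewrite (negbTE il2) orbF => /greedy_mem.
by rewrite finset.inE (negbTE il1).
Qed.

Lemma greedy_skip acc A l i : i \notin greedy acc A l ->
  greedy acc A l = greedy acc A [seq j <- l | j != i].
Proof.
elim: l A => [|e l IH] A //= H; rewrite IH //; case: (eqVneq e i) H => //= ->.
case: ifP => // _ /negP[].
by apply: (fintype.subsetP (greedy_sub _ _ _)); rewrite !finset.inE eqxx.
Qed.

Lemma eq_in_greedy acc acc' A l :
  (forall B j, j \in l -> acc B j = acc' B j) -> greedy acc A l = greedy acc' A l.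
Proof.
elim: l A => [|e l IH] A //= H; rewrite H ?mem_head // IH // => B j jl.
by apply: H; rewrite inE jl orbT.
Qed.

(** Each acceptance lowers [Rv] by exactly the price; a rejection leaves it unchanged. Uniqueness
    makes [index i l] the moment at which [i] arrives. *)
Lemma greedy_telescope (R : zmodType) (Rv : {set 'I_n} -> R) acc l : uniq l ->
  Rv fset0 - Rv (greedy acc fset0 l) =
  \sum_(i <- l) let A := greedy acc fset0 (take (index i l) l) in
     if acc A i then Rv A - Rv (i |: A) else 0.
Proof.
elim/last_ind: l => [|l e IH]; first by rewrite big_nil subrr.
rewrite rcons_uniq => /andP[el ul].
rewrite -cats1 big_cat big_seq1 /= greedy_cat /=.
rewrite index_cat (negbTE el) /= eqxx addn0 take_size_cat //.
under eq_big_seq => i il do rewrite index_cat il takel_cat ?index_size //.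
rewrite -IH //; case: ifP => _; last by rewrite addr0.
by rewrite addrA subrK.
Qed.

Section arrival.
Variable le : rel 'I_n.
Hypotheses (le_total : total le) (le_trans : transitive le) (le_anti : antisymmetric le).

Let order := sort le (enum 'I_n).
Let earlier i j := le j i && (j != i).

Let order_uniq : uniq order. Proof. by rewrite sort_uniq enum_uniq. Qed.
Let mem_order i : i \in order. Proof. by rewrite mem_sort mem_enum. Qed.
Let order_sorted : sorted le order. Proof. exact: sort_sorted. Qed.

(** A prefix written as a filter commutes with filtering by a deadline. Antisymmetry excludes the
    later elements. *)
Lemma filter_earlier s i : sorted le s -> uniq s -> i \in s ->
  [seq j <- s | earlier i j] = take (index i s) s.
Proof.
move=> ss us is_; move: ss us; case/splitPr: is_ => p1 p2.
rewrite (sorted_pairwise le_trans) pairwise_cat pairwise_cons allrel_consr.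
move=> /and4P[/andP[/allP lei _] _ /allP gei _].
rewrite cat_uniq => /and3P[_ /hasPn /= ip1 /andP[ip2 _]].
have {}ip1 : i \notin p1 by apply: (ip1 i); rewrite mem_head.
rewrite index_cat (negbTE ip1) /= eqxx addn0 take_size_cat // filter_cat /=.
rewrite {2}/earlier eqxx andbF (_ : [seq j <- p2 | _] = [::]) ?cats0; last first.
  apply/eqP; rewrite -(negbK (_ == _)) -has_filter; apply/hasPn => j jp2.
  rewrite /earlier; apply/negP => /andP[ji /negP[]]; apply/eqP/le_anti.
  by rewrite ji gei.
apply/all_filterP/allP => j jp1; rewrite /earlier (lei _ jp1).
by apply: contraNneq ip1 => <-.
Qed.

Lemma filter_down_closed s (p : pred 'I_n) : sorted le s ->
  (forall i j, le j i -> p i -> p j) ->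
  s = [seq j <- s | p j] ++ [seq j <- s | ~~ p j].
Proof.
move=> + down; elim: s => //= a s IH.
rewrite (path_sortedE le_trans) => /andP[/allP leas /IH {}IH].
have [pa|npa] := boolP (p a); first by rewrite /= -IH.
rewrite (_ : [seq j <- s | p j] = [::]) /=.
  congr cons; apply/esym/all_filterP/allP => j js.
  by apply: contra npa => /(down _ _ (leas _ js)).
apply/eqP; rewrite -(negbK (_ == _)) -has_filter; apply/hasPn => j js.
by apply: contra npa => /(down _ _ (leas _ js)).
Qed.

Definition selected_before acc i := greedy acc fset0 [seq j <- order | earlier i j].

Lemma mem_greedy_order acc i :
  (i \in greedy acc fset0 order) = acc (selected_before acc i) i.
Proof.
have ord : order = [seq j <- order | earlier i j] ++ i :: drop (index i order).+1 order.
  rewrite filter_earlier //.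
  rewrite -[X in _ ++ X :: _](nth_index i (mem_order i)) -drop_nth ?index_mem //.
  by rewrite cat_take_drop.
by rewrite {1}ord greedy_split // -ord.
Qed.

(** Here [p] is a deadline: being closed under earlier arrivals, it leaves the set met by each [i]
    satisfying it unchanged. *)
Lemma selected_telescope (R : zmodType) (Rv : {set 'I_n} -> R) acc (p : pred 'I_n) :
  (forall i j, le j i -> p i -> p j) ->
  Rv fset0 - Rv (greedy acc fset0 [seq j <- order | p j]) =
  \sum_(i | p i) let A := selected_before acc i in
     if acc A i then Rv A - Rv (i |: A) else 0.
Proof.
move=> down; rewrite greedy_telescope ?filter_uniq //.
rewrite (perm_big [seq j <- enum 'I_n | p j]) /=; last first.
  by apply: perm_filter; rewrite perm_sort.
rewrite big_filter big_enum_cond /=.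
apply: eq_bigr => i pi.
rewrite -filter_earlier ?filter_uniq ?mem_filter ?pi ?mem_order //; last first.
  exact: sorted_filter.
rewrite /selected_before -filter_predI (@eq_filter _ _ (earlier i)) //.
move=> j /=; case e : (earlier i j) => //=.
by move/andP: e => [/down -> //].
Qed.

End arrival.

(* If [i] is not taken by the deadline [p], the run is the one without [i]; hence
   re-inserting [i] at the deadline finds only elements taken in the original run. *)
Lemma selected_before_sub (le le' : rel 'I_n) acc acc' (p : pred 'I_n) i :
  total le -> transitive le -> antisymmetric le ->
  total le' -> transitive le' -> antisymmetric le' ->
  (forall j k, j != i -> k != i -> le j k = le' j k) ->
  (forall A j, j != i -> acc A j = acc' A j) ->
  (forall j, j != i -> le' j i -> p j) ->
  i \notin greedy acc fset0 [seq j <- sort le (enum 'I_n) | p j] ->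
  selected_before le' acc' i \subset
    greedy acc fset0 [seq j <- sort le (enum 'I_n) | p j].
Proof.
move=> tot trans anti tot' trans' anti' eqle eqacc lep nG.
rewrite (greedy_skip nG).
set L := [seq j <- _ | j != i].
have Li j : j \in L -> j != i by rewrite mem_filter => /andP[].
have sL : sorted le' L.
  rewrite -(@eq_in_sorted _ (fun j => j != i) le le').
  - by do 2! apply: sorted_filter => //; exact: sort_sorted.
  - by move=> j k ji ki; exact: eqle.
  - exact/allP.
(* The arrivals before [i] in the order [le'] form a prefix of [L], and the run only grows along the
   rest of [L]. *)
rewrite (filter_down_closed (le := le') trans' (p := fun j => le' j i) sL); last first.
  by move=> j k kj ji; exact: trans' kj ji.
rewrite greedy_cat.
(* Both lists are sorted by [le'] with the same elements: by [lep], every arrival before [i] meets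
   the deadline. *)
suff -> : [seq j <- L | le' j i] =
    [seq j <- sort le' (enum 'I_n) | le' j i && (j != i)].
  rewrite /selected_before -(@eq_in_greedy acc acc') ?greedy_sub //.
  by move=> B j; rewrite mem_filter => /andP[/andP[_ ji] _]; exact: eqacc.
apply: (sorted_eq trans' anti').
- exact: sorted_filter.
- by apply: sorted_filter => //; exact: sort_sorted.
- rewrite /L -!filter_predI.
  rewrite perm_sym (perm_trans (y := [seq j <- enum 'I_n | le' j i && (j != i)])) //.
    by apply: perm_filter; rewrite perm_sort.
  rewrite perm_sym (@eq_filter _ _ (fun j => le' j i && (j != i))).
    by apply: perm_filter; rewrite perm_sort.
  move=> j /=; case: (le' j i) (@lep j) => //= lepj.
  by case: (j != i) lepj => //= /(_ isT isT) ->.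
Qed.

End greedy_selection.

(** * Online algorithms from rules on the selected set *)

Section replay.
Variables (R : realType) (n : nat) (M : matroid n).
Variable acc : {set 'I_n} -> 'I_n -> R -> R -> bool.
Hypothesis acc_indep : forall A i t x, acc A i t x -> indep M (i |: A).

Let replay (h : history R n) : {set 'I_n} :=
  foldl (fun A e => if acc A e.1.1 e.1.2 e.2 then e.1.1 |: A else A) fset0 h.

(** The history determines the selected set: [replay] reruns the rule on the recorded times and
    values. *)
Definition set_alg : online_alg R n := fun h i t x u => acc (replay h) i t x.

(** As [acc] accepts only feasible elements, [online_step] never overrules it, and the replayed set
    is the actual one. *)
Lemma selected_set_alg t x u :
  selected M set_alg t x u =
  greedy (fun A i => acc A i (t i) (x i)) fset0 (arrival_order t).
Proof.
rewrite /selected -[in RHS](_ : replay [::] = fset0) // -[in LHS](_ : replay [::] = fset0) //.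
elim: (arrival_order t) [::] => //= e l IH h.
have replayE : replay (rcons h (e, t e, x e)) =
    if acc (replay h) e (t e) (x e) then e |: replay h else replay h.
  by rewrite /replay foldl_rcons.
rewrite -replayE -IH; congr (foldl _ _ _).2; congr pair.
rewrite replayE /set_alg.
by case a : (acc _ _ _ _) => //=; rewrite (acc_indep a).
Qed.

End replay.

Section arrival_relation.
Variables (R : realType) (n : nat) (t : 'I_n -> R).

(** The comparison that [arrival_order] sorts by; breaking ties by index makes it antisymmetric. *)
Definition arrives_le : rel 'I_n :=
  fun i j => (t i < t j) || ((t i == t j) && (i <= j)%N).

Lemma arrives_le_total : total arrives_le.
Proof.
by move=> i j; rewrite /arrives_le; case: (ltgtP (t i) (t j)) => //= _; exact: leq_total.
Qed.

Lemma arrives_le_trans : transitive arrives_le.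
Proof.
move=> j i k /orP[ij|/andP[/eqP ij lij]] /orP[jk|/andP[/eqP jk ljk]]; rewrite /arrives_le.
- by rewrite (lt_trans ij jk).
- by rewrite -jk ij.
- by rewrite ij jk.
- by rewrite ij jk eqxx (leq_trans lij ljk) orbT.
Qed.

Lemma arrives_le_anti : antisymmetric arrives_le.
Proof.
move=> i j /andP[]; rewrite /arrives_le; case: (ltgtP (t i) (t j)) => //= _ ij ji.
by apply/val_inj/anti_leq; rewrite ij.
Qed.

Lemma arrives_leW i j : arrives_le i j -> t i <= t j.
Proof. by rewrite /arrives_le; case: ltgtP. Qed.

End arrival_relation.

(** * Laws on a finite product of lines *)

Local Open Scope classical_set_scope.

Section finite_product.
Variables (R : realType) (J : finType).

Definition sample := J -> R.
HB.instance Definition _ := gen_eqMixin sample.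
HB.instance Definition _ := gen_choiceMixin sample.
HB.instance Definition _ := isPointed.Build sample (fun=> 0).

Definition box (B : J -> set R) : set sample := [set z | forall j, B j (z j)].

Definition boxes : set (set sample) :=
  [set box B | B in [set B | forall j, measurable (B j)]].

(** The product sigma-algebra, presented by its pi-system of measurable boxes so that a law is
    determined by its values on boxes. *)
Definition sample_space : measurableType (sigma_display boxes) :=
  g_sigma_algebraType boxes.

Lemma boxes_setI : setI_closed boxes.
Proof.
move=> _ _ [B mB <-] [C mC <-]; exists (fun j => B j `&` C j).
  by move=> j; exact: measurableI.
by apply/seteqP; split=> [z H|z [HB HC] j]; [split=> j; case: (H j)|split].
Qed.

Lemma box_setT : box (fun=> setT) = setT.
Proof. by apply/seteqP; split. Qed.

Lemma measurable_box B : (forall j, measurable (B j)) ->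
  measurable (box B : set sample_space).
Proof. by move=> mB; apply: sub_sigma_algebra; exists B. Qed.

Lemma measurable_coord j : measurable_fun setT (fun z : sample_space => z j).
Proof.
move=> _ Y mY; rewrite setTI.
rewrite (_ : _ @^-1` _ = box (fun k => if k == j then Y else setT)).
  by apply: measurable_box => k; case: eqP.
apply/seteqP; split => [z Yz k|z /(_ j)]; last by rewrite eqxx.
by case: eqP => // ->.
Qed.

Lemma measurable_to_sample d (T : measurableType d) (f : T -> sample_space) :
  (forall j, measurable_fun setT (fun w => f w j)) -> measurable_fun setT f.
Proof.
move=> mf; apply: (@measurability _ _ _ _ setT f boxes erefl) => _ [_ [B mB <-] <-].
rewrite setTI (_ : _ @^-1` _ = \bigcap_(j in [set: J]) (fun w => f w j) @^-1` (B j)).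
  apply: fin_bigcap_measurable => // j _.
  by rewrite -[X in measurable X]setTI; exact: mf.
by apply/seteqP; split=> [w H j _|w H j]; [exact: H|exact: (H j)].
Qed.

Lemma sample_measure_unique (m1 m2 : {measure set sample_space -> \bar R}) :
  (m1 setT < +oo)%E ->
  (forall B, (forall j, measurable (B j)) -> m1 (box B) = m2 (box B)) ->
  forall A, measurable A -> m1 A = m2 A.
Proof.
move=> fin eqm A mA; apply: (@measure_unique _ R sample_space boxes (fun=> setT)) => //.
- exact: boxes_setI.
- by move=> _; exists (fun=> setT) => //; exact: box_setT.
- by rewrite bigcup_const.
- by move=> _ [B mB <-]; exact: eqm.
Qed.

(** Both sides integrate [f] against pushforward laws, which agree on boxes and hence everywhere. *)
Lemma ge0_integral_law d1 d2 (T1 : measurableType d1) (T2 : measurableType d2)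
    (m1 : {measure set T1 -> \bar R}) (m2 : {measure set T2 -> \bar R})
    (X : T1 -> sample_space) (Y : T2 -> sample_space) (f : sample_space -> \bar R) :
  (m1 setT < +oo)%E -> measurable_fun setT X -> measurable_fun setT Y ->
  (forall B, (forall j, measurable (B j)) -> m1 (X @^-1` box B) = m2 (Y @^-1` box B)) ->
  measurable_fun setT f -> (forall z, 0 <= f z)%E ->
  (\int[m1]_w f (X w) = \int[m2]_w f (Y w))%E.
Proof.
move=> fin mX mY eqm mf f0.
rewrite -[LHS](@ge0_integral_pushforward _ _ _ _ _ X mX m1 setT) //.
rewrite -[RHS](@ge0_integral_pushforward _ _ _ _ _ Y mY m2 setT) //.
apply: eq_measure_integral => A mA _.
exact: (@sample_measure_unique (pushforward m1 X) (pushforward m2 Y)).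
Qed.

(** Partial resampling: coordinate [j] is read at place [s j] of a pair of samples, later two
    independent draws. *)
Definition mix (s : J -> J + J) (z z' : sample_space) : sample_space :=
  fun j => match s j with inl k => z k | inr k => z' k end.

Lemma measurable_mix s : measurable_fun setT (fun w => mix s w.1 w.2).
Proof.
apply: measurable_to_sample => j; rewrite /mix; case: (s j) => k.
  exact: (measurableT_comp (measurable_coord k) measurable_fst).
exact: (measurableT_comp (measurable_coord k) measurable_snd).
Qed.

Variable Q : probability sample_space R.
Hypothesis Q_indep : forall B, (forall j, measurable (B j)) ->
  Q (box B) = (\prod_j Q ((fun z : sample_space => z j) @^-1` (B j)))%E.

Let law (j : J + J) : set R -> \bar R :=
  match j with inl k | inr k => fun A => Q ((fun z : sample_space => z k) @^-1` A) end.

(** The mixed sample has law [Q] again: injectivity makes its coordinates distinct, hence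
    independent, coordinates of the pair, and their marginals are the right ones. *)
Lemma mix_law s (f : sample_space -> \bar R) :
  injective s -> (forall j A, measurable A -> law (s j) A = law (inl j) A) ->
  measurable_fun setT f -> (forall z, 0 <= f z)%E ->
  (\int[Q]_z f z = \int[Q]_z \int[Q]_z' f (mix s z z'))%E.
Proof.
move=> s_inj s_law mf f0.
rewrite -(@fubini_tonelli1 _ _ _ _ _ Q Q (fun w => f (mix s w.1 w.2))) //; last first.
  exact: (measurableT_comp mf (measurable_mix s)).
apply: (@ge0_integral_law _ _ _ _ Q (Q \x Q)%E id) => //.
- exact: (le_lt_trans (probability_le1 Q measurableT) (ltry _)).
- exact: measurable_mix.
move=> B mB; rewrite preimage_id.
(* The constraint on place [k] of the pair: that of the unique [j] read there, and none if no [j]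
   reads it. *)
pose C (k : J + J) : set R := if [pick j | s j == k] is Some j then B j else setT.
have Cs j : C (s j) = B j.
  rewrite /C; case: pickP => [k /eqP/s_inj -> //|/(_ j)]; by rewrite eqxx.
have mC k : measurable (C k) by rewrite /C; case: pickP.
rewrite (_ : _ @^-1` _ = box (C \o inl) `*` box (C \o inr)); last first.
  apply/seteqP; split=> [[z z'] /= H|[z z'] /= [H H'] j].
    split=> j; rewrite /C /=; case: pickP => // k /eqP sk;
    by have := H k; rewrite /mix sk.
  by rewrite /mix -Cs; case: (s j) => k; [exact: H|exact: H'].
apply: (etrans (Q_indep mB)).
transitivity (\prod_(k : J + J) law k (C k))%E; last first.
  rewrite big_sumType; apply: esym.
  apply: (etrans (product_measure1E Q Q (measurable_box _) (measurable_box _))).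
  - by move=> j; exact: mC.
  - by move=> j; exact: mC.
  - by congr (_ * _)%E; apply: Q_indep => j; exact: mC.
(* Places that are not read contribute factors 1. *)
rewrite (bigID (fun k => k \in codom s)) /= [X in (_ * X)%E]big1 ?mule1; last first.
  move=> k ks; rewrite /C; case: pickP => [j /eqP sj|_].
    by move: ks; rewrite -sj codom_f.
  by rewrite /law; case: k {ks} => k; rewrite preimage_setT probability_setT.
rewrite -big_uniq /=; last by rewrite map_inj_uniq ?enum_uniq.
rewrite big_map big_enum /=; apply: eq_bigr => j _.
by rewrite s_law // Cs.
Qed.

End finite_product.

(** * Measurability through finitely many tests *)

Section discrete_dependence.
Context d (T : measurableType d) (D : finType).

Lemma measurable_fun_finite d' (U : measurableType d') (c : T -> D) (h : D -> T -> U) :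
  (forall y, measurable (c @^-1` [set y])) ->
  (forall y, measurable_fun setT (h y)) ->
  measurable_fun setT (fun z => h (c z) z).
Proof.
move=> mc mh _ Y mY; rewrite setTI.
rewrite (_ : _ @^-1` _ = \bigcup_(y in [set: D]) (c @^-1` [set y] `&` h y @^-1` Y)).
  apply: fin_bigcup_measurable => // y _; apply: measurableI => //.
  by rewrite -[X in measurable X]setTI; exact: mh.
apply/seteqP; split=> [z Yz|z [y _ [/= <-]]] //; by exists (c z).
Qed.

Lemma measurable_ffun_bool (K : finType) (b : K -> T -> bool) :
  (forall k, measurable_fun setT (b k)) ->
  forall y, measurable ((fun z => [ffun k => b k z]) @^-1` [set y]).
Proof.
move=> mb y.
rewrite (_ : _ @^-1` _ = \bigcap_(k in [set: K]) b k @^-1` [set y k]).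
  apply: fin_bigcap_measurable => // k _.
  by rewrite -[X in measurable X]setTI; exact: mb.
apply/seteqP; split=> [z <- k _ /=|z H]; first by rewrite ffunE.
by apply/ffunP => k; rewrite ffunE; exact: H.
Qed.

End discrete_dependence.

(** * Time weights *)

Section time_weight.
Variable R : realType.

(* The clamping makes [uniform_time_weight] hold for every real [r], so that no
   almost-sure restriction of arrival times to [0, 1] is needed. *)
Definition time_weight (s : R) : R := expR (Num.min (Num.max s 0) 1 - 1).

Lemma time_weight_gt0 s : 0 < time_weight s.
Proof. exact: expR_gt0. Qed.

Lemma time_weight_le1 s : time_weight s <= 1.
Proof.
rewrite /time_weight -[leRHS]expR0 ler_expR subr_le0.
by rewrite ge_min lexx orbT.
Qed.

Lemma measurable_time_weight : measurable_fun setT time_weight.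
Proof.
apply: measurableT_comp => //; apply: measurable_funD => //.
by apply: measurable_minr => //; apply: measurable_maxr.
Qed.

Lemma uniform_probE (A : set R) : measurable A ->
  uniform_prob (@ltr01 R) A = lebesgue_measure (A `&` `[0, 1]).
Proof.
move=> mA; rewrite /uniform_prob integral_uniform_pdf.
rewrite (eq_integral (cst 1%E)) ?integral_cst ?mul1e //.
- exact: measurableI.
- move=> x; rewrite inE => -[_ /=]; rewrite in_itv /= /uniform_pdf => ->.
  by rewrite subr0 invr1.
Qed.

Lemma integral_expR_itv (a : R) : a <= 1 ->
  (\int[lebesgue_measure]_(s in `[a, 1%R]%classic) (expR (s - 1)%R)%:E = (1 - expR (a - 1))%R%:E)%E.
Proof.
rewrite le_eqVlt => /orP[/eqP ->|a1].
  by rewrite set_itv1 integral_set1 subrr expR0 subrr.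
have d (x : R) : is_derive x 1 (fun s : R => expR (s - 1)) (expR (x - 1)).
  by apply: is_derive_eq; rewrite subr0 mulr1.
have c (x : R) : {for x, continuous (fun s : R => expR (s - 1))}.
  by apply: differentiable_continuous; apply/derivable1_diffP; case: (d x).
rewrite (@continuous_FTC2 _ _ (fun s => expR (s - 1))) //.
- by rewrite subrr expR0.
- by apply: continuous_subspaceT => x; exact: c.
- split.
  + by move=> x _; case: (d x).
  + by apply: cvg_at_right_filter; exact: c.
  + by apply: cvg_at_left_filter; exact: c.
- by move=> x _; rewrite derive1E derive_val.
Qed.

(** On [0, 1] this is the integral of [exp (s - 1)] over [r, 1]. For [r > 1] both sides are 0; for
    [r < 0] both equal their value at 0. *)
Lemma uniform_time_weight (r : R) :
  (\int[uniform_prob (@ltr01 R)]_s (time_weight s * (r <= s)%R%:R)%R%:E =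
   (1 - time_weight r)%R%:E)%E.
Proof.
rewrite integral_uniform //=; last 2 first.
- apply/measurable_EFinP/measurable_funM; first exact: measurable_time_weight.
  rewrite (_ : (fun _ => _) = fun s => if r <= s then 1 else 0); last first.
    by apply/funext => s; case: ifP.
  by apply: measurable_fun_ifT => //; exact: measurable_fun_ler.
- by move=> s; rewrite lee_fin mulr_ge0 // ltW // time_weight_gt0.
rewrite subr0 invr1 mul1e; have [r1|r1] := leP r 1; last first.
  rewrite integral0_eq; last first.
    move=> s /=; rewrite in_itv /= => /andP[_ s1].
    by rewrite leNgt (le_lt_trans s1 r1) mulr0.
  rewrite /time_weight (_ : Num.min _ _ = 1) ?subrr ?expR0 ?subrr //.
  by apply/min_idPr; rewrite le_max ltW.
have a1 : Num.max r 0 <= 1 by rewrite ge_max r1 ler01.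
rewrite /time_weight (min_idPl a1) -integral_expR_itv //.
rewrite (_ : `[Num.max r 0, 1]%classic = `[0, 1]%classic `&` `[Num.max r 0, 1]%classic).
  rewrite integral_mkcondr; apply: eq_integral => s; rewrite inE /= in_itv /=.
  move=> /andP[s0 s1]; rewrite patchE (max_idPl s0) (min_idPl s1).
  rewrite (_ : (s \in _) = (r <= s)); first by case: ifP; rewrite ?mulr1 ?mulr0.
  apply/idP/idP; rewrite inE /= in_itv /= ge_max s0 s1 !andbT //.
apply/seteqP; split=> [s|s [_ //]] /=; rewrite !in_itv /= ge_max.
by move=> /andP[/andP[-> ->] ->].
Qed.

End time_weight.

(** * The threshold algorithm *)

Lemma measurable_bigmaxr d (T : measurableType d) (R : realType) (I : Type) (s : seq I)
    (P : pred I) (f : I -> T -> R) : (forall i, measurable_fun setT (f i)) ->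
  measurable_fun setT (fun z => \big[Order.max/0]_(i <- s | P i) f i z).
Proof.
move=> mf; elim: s => [|i s IH].
  by under eq_fun do rewrite big_nil; exact: measurable_cst.
under eq_fun do rewrite big_cons; case: (P i) => //.
exact: (measurable_maxr (mf i) IH).
Qed.

Section threshold_algorithm.
Variables (R : realType) (n : nat) (M : matroid n).

Local Notation J := (('I_n + 'I_n) + unit)%type.
Local Notation E := (sample_space R J).

Definition value_of (z : E) : 'I_n -> R := fun i => z (inl (inl i)).
Definition time_of (z : E) : 'I_n -> R := fun i => z (inl (inr i)).
Definition seed_of (z : E) : R := z (inr tt).

Lemma measurable_value_of i : measurable_fun setT (value_of ^~ i).
Proof. exact: measurable_coord. Qed.

Lemma measurable_time_of i : measurable_fun setT (time_of ^~ i).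
Proof. exact: measurable_coord. Qed.

Lemma measurable_seed_of : measurable_fun setT seed_of.
Proof. exact: measurable_coord. Qed.

Lemma measurable_contracted_opt A :
  measurable_fun setT (fun z => contracted_opt M A (value_of z)).
Proof.
apply: measurable_bigmaxr => S /=.
rewrite (_ : (fun z => _) = fun z => \sum_i (if i \in S then value_of z i else 0)).
  apply: measurable_sum => i.
  by case: (i \in S); [exact: measurable_value_of|exact: measurable_cst].
by apply/funext => z; rewrite big_mkcond.
Qed.

Variable Q : probability E R.
Hypothesis Q_indep : forall B, (forall j, measurable (B j)) ->
  Q (box B) = (\prod_j Q ((fun z : E => z j) @^-1` (B j)))%E.
Hypothesis Q_time : forall i A, measurable A ->
  Q ((time_of ^~ i) @^-1` A) = lebesgue_measure (A `&` `[0, 1]).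
Hypothesis Q_seed : forall A, measurable A ->
  Q (seed_of @^-1` A) = lebesgue_measure (A `&` `[0, 1]).
Hypothesis opt_fin : (\int[Q]_z (opt_value M (value_of z))%:E < +oo)%E.

Lemma integral_seed (h : R -> \bar R) : measurable_fun setT h -> (forall s, 0 <= h s)%E ->
  (\int[Q]_z h (seed_of z) = \int[uniform_prob (@ltr01 R)]_s h s)%E.
Proof.
move=> mh h0.
rewrite -[LHS](@ge0_integral_pushforward _ _ _ (measurableTypeR R) _ seed_of
  measurable_seed_of Q setT) //.
apply: eq_measure_integral => [|? A mA _]; first exact: measurable_seed_of.
exact: (etrans (Q_seed mA) (esym (uniform_probE mA))).
Qed.

Definition residual A : R := fine (\int[Q]_z (contracted_opt M A (value_of z))%:E)%E.

(** A set feasible in the contraction is independent, so the integral is at most that in [opt_fin]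
    and [fine] loses nothing. *)
Lemma integral_contracted_opt A :
  (\int[Q]_z (contracted_opt M A (value_of z))%:E = (residual A)%:E)%E.
Proof.
rewrite /residual fineK // ge0_fin_numE; last first.
  by apply: integral_ge0 => z _; rewrite lee_fin contracted_opt_ge0.
apply: le_lt_trans opt_fin; apply: ge0_le_integral => //.
- by move=> z _; rewrite lee_fin contracted_opt_ge0.
- by apply/measurable_EFinP; exact: measurable_contracted_opt.
- apply/measurable_EFinP; under eq_fun do rewrite -contracted_opt0.
  exact: measurable_contracted_opt.
- move=> z _; rewrite lee_fin -contracted_opt0.
  have [iA|nA] := boolP (indep M A); last first.
    by rewrite contracted_opt_dependent // contracted_opt_ge0.
  have [S [dS iS ->]] := contracted_opt_attained (value_of z) iA.
  apply: contracted_opt_ub; first by rewrite -setI_eq0 finset.set0I.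
  by rewrite finset.set0U; apply: indep_sub iS; exact: finset.subsetUr.
Qed.

Lemma residual_ge0 A : 0 <= residual A.
Proof.
by rewrite fine_ge0 //; apply: integral_ge0 => z _; rewrite lee_fin contracted_opt_ge0.
Qed.

Lemma residual_decr (A : {set 'I_n}) i : i \notin A -> residual (i |: A) <= residual A.
Proof.
move=> iA; rewrite -lee_fin -!integral_contracted_opt; apply: ge0_le_integral => //.
- by move=> z _; rewrite lee_fin contracted_opt_ge0.
- by apply/measurable_EFinP; exact: measurable_contracted_opt.
- by apply/measurable_EFinP; exact: measurable_contracted_opt.
- by move=> z _; rewrite lee_fin contracted_opt_decr.
Qed.

Lemma residual_supermodular (A : {set 'I_n}) i j : i != j -> i \notin A -> j \notin A ->
  indep M (i |: (j |: A)) ->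
  residual A + residual (i |: (j |: A)) <= residual (i |: A) + residual (j |: A).
Proof.
move=> ij iA jA ind; rewrite -lee_fin !EFinD -!integral_contracted_opt.
rewrite -!ge0_integralD //; try by [move=> z _; rewrite lee_fin contracted_opt_ge0
  |apply/measurable_EFinP; exact: measurable_contracted_opt].
apply: ge0_le_integral => //.
- by move=> z _; rewrite -EFinD lee_fin addr_ge0 ?contracted_opt_ge0.
- by apply: emeasurable_funD; apply/measurable_EFinP; exact: measurable_contracted_opt.
- by apply: emeasurable_funD; apply/measurable_EFinP; exact: measurable_contracted_opt.
- by move=> z _; rewrite -!EFinD lee_fin contracted_opt_supermodular.
Qed.

Let prc := price residual.

Lemma price_ge0 (A : {set 'I_n}) i : i \notin A -> 0 <= prc A i.
Proof. by move=> iA; rewrite subr_ge0 residual_decr. Qed.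

Definition discount (s : R) : R := 1 - time_weight s.

Lemma discount_ge0 s : 0 <= discount s.
Proof. by rewrite subr_ge0 time_weight_le1. Qed.

Lemma measurable_discount : measurable_fun setT discount.
Proof. by apply: measurable_funB => //; exact: measurable_time_weight. Qed.

Definition accepts (A : {set 'I_n}) i (t x : R) : bool :=
  [&& i \notin A, indep M (i |: A) & discount t * prc A i <= x].

Definition surplus i A (s x : R) : R :=
  if accepts A i s x then x - discount s * prc A i else 0.

Lemma surplus_ge0 i A s x : 0 <= surplus i A s x.
Proof. by rewrite /surplus; case: ifP => // /and3P[_ _]; rewrite subr_ge0. Qed.

(** An [i] accepted at [B] is also accepted at [A], where its price is no higher; if it is refused
    at [B] the left side is 0. *)
Lemma surplus_mono i (A B : {set 'I_n}) s x : A \subset B ->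
  surplus i B s x <= surplus i A s x.
Proof.
move=> AB; rewrite {1}/surplus; case: ifP => [|_]; last exact: surplus_ge0.
move=> /and3P[iB indB le]; have iA : i \notin A by apply: contra iB; exact: fintype.subsetP.
have indA : indep M (i |: A) by apply: indep_sub indB; exact: finset.setUS.
have pAB : discount s * prc A i <= discount s * prc B i.
  by rewrite ler_wpM2l ?discount_ge0 // (price_mono residual_supermodular).
by rewrite /surplus /accepts iA indA (le_trans pAB le) lerB.
Qed.

(* The optimum of the contraction for fresh values is one way of collecting surplus,
   and its total price is at most [residual A]. *)
Lemma surplus_sum A s (x : 'I_n -> R) :
  contracted_opt M A x <= \sum_i surplus i A s (x i) + discount s * residual A.
Proof.
have dR : 0 <= discount s * residual A by rewrite mulr_ge0 ?discount_ge0 ?residual_ge0.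
have [iA|nA] := boolP (indep M A); last first.
  rewrite contracted_opt_dependent // addr_ge0 // sumr_ge0 // => i _.
  exact: surplus_ge0.
have [S [dS iS ->]] := contracted_opt_attained x iA.
have ps := price_sum residual_ge0 residual_supermodular dS iS.
rewrite -lerBlDr; apply: (@le_trans _ _ (\sum_(i in S) surplus i A s (x i))); last first.
  rewrite [leRHS](bigID (fun i => i \in S)) /= lerDl sumr_ge0 // => i _.
  exact: surplus_ge0.
apply: (@le_trans _ _ (\sum_(i in S) (x i - discount s * prc A i))).
  by rewrite sumrB lerB // -mulr_sumr ler_wpM2l ?discount_ge0.
(* Elements of [S] are feasible at [A], so one is refused only below its threshold, where its term
   is at most 0. *)
apply: ler_sum => i iS'; rewrite /surplus /accepts (disjointFl dS iS').
rewrite (indep_sub _ iS) /=; last first.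
  by apply/fintype.subsetP => y; rewrite !finset.inE => /orP[/eqP->|->//]; rewrite iS' orbT.
by case: (leP (discount s * prc A i) (x i)) => // /ltW; rewrite subr_le0.
Qed.

(** * Sets met by arrivals and by the seed *)

Definition before (z : E) i :=
  selected_before (arrives_le (time_of z))
    (fun A j => accepts A j (time_of z j) (value_of z j)) i.

(** The set [A_s] with the seed as the random time [s]. *)
Definition by_seed (z : E) :=
  greedy (fun A j => accepts A j (time_of z j) (value_of z j)) fset0
    [seq j <- sort (arrives_le (time_of z)) (enum 'I_n) | time_of z j <= seed_of z].

Local Notation K := (('I_n * 'I_n + {set 'I_n} * 'I_n) + 'I_n)%type.

(** These finitely many measurable tests determine [before] and [by_seed]; decisions are tabulated
    at every possible set [A], so that the run can be recomputed from the table. *)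
Let test (k : K) (z : E) : bool :=
  match k with
  | inl (inl (i, j)) => arrives_le (time_of z) i j
  | inl (inr (A, i)) => accepts A i (time_of z i) (value_of z i)
  | inr i => time_of z i <= seed_of z
  end.

Let code z : {ffun K -> bool} := [ffun k => test k z].

Lemma measurable_accepts d (T : measurableType d) A i (f g : T -> R) :
  measurable_fun setT f -> measurable_fun setT g ->
  measurable_fun setT (fun w => accepts A i (f w) (g w)).
Proof.
move=> mf mg; rewrite /accepts.
case: (i \notin A) => /=; last exact: measurable_cst.
case: (indep M _) => /=; last exact: measurable_cst.
apply: measurable_fun_ler => //; apply: measurable_funM => //.
exact: (measurableT_comp measurable_discount).
Qed.

Lemma measurable_surplus d (T : measurableType d) A i (f g : T -> R) :
  measurable_fun setT f -> measurable_fun setT g ->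
  measurable_fun setT (fun w => surplus i A (f w) (g w)).
Proof.
move=> mf mg; rewrite /surplus; apply: measurable_fun_ifT => //.
  exact: measurable_accepts.
apply: measurable_funB => //; apply: measurable_funM => //.
exact: (measurableT_comp measurable_discount).
Qed.

Let measurable_code y : measurable (code @^-1` [set y]).
Proof.
apply: (measurable_ffun_bool (b := test)) => -[[[i j]|[A i]]|i] /=.
- apply: measurable_or; first by apply: measurable_fun_ltr; exact: measurable_time_of.
  apply: measurable_and => //.
  by apply: measurable_fun_eqr; exact: measurable_time_of.
- by apply: measurable_accepts; [exact: measurable_time_of|exact: measurable_value_of].
- by apply: measurable_fun_ler; [exact: measurable_time_of|exact: measurable_seed_of].
Qed.

Let before_code (y : {ffun K -> bool}) i :=
  selected_before (fun j k => y (inl (inl (j, k)))) (fun A j => y (inl (inr (A, j)))) i.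

Let by_seed_code (y : {ffun K -> bool}) :=
  greedy (fun A j => y (inl (inr (A, j)))) fset0
    [seq j <- sort (fun j k => y (inl (inl (j, k)))) (enum 'I_n) | y (inr j)].

Lemma beforeE z i : before z i = before_code (code z) i.
Proof.
rewrite /before /before_code; congr (selected_before _ _ _).
- by apply/funext => j; apply/funext => k; rewrite ffunE.
- by apply/funext => A; apply/funext => j; rewrite ffunE.
Qed.

Lemma by_seedE z : by_seed z = by_seed_code (code z).
Proof.
rewrite /by_seed /by_seed_code; congr (greedy _ _ _).
  by apply/funext => A; apply/funext => j; rewrite ffunE.
have -> : (fun j k => code z (inl (inl (j, k)))) = arrives_le (time_of z).
  by apply/funext => j; apply/funext => k; rewrite ffunE.
by apply: eq_filter => j; rewrite ffunE.
Qed.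

Lemma measurable_before d (U : measurableType d) i (h : {set 'I_n} -> E -> U) :
  (forall A, measurable_fun setT (h A)) -> measurable_fun setT (fun z => h (before z i) z).
Proof.
move=> mh; under eq_fun do rewrite beforeE.
exact: (measurable_fun_finite (h := fun y => h (before_code y i))).
Qed.

Lemma measurable_by_seed d d' (T : measurableType d) (U : measurableType d')
    (f : T -> E) (h : {set 'I_n} -> T -> U) : measurable_fun setT f ->
  (forall A, measurable_fun setT (h A)) ->
  measurable_fun setT (fun w => h (by_seed (f w)) w).
Proof.
move=> mf mh; under eq_fun do rewrite by_seedE.
apply: (measurable_fun_finite (c := fun w => code (f w))
  (h := fun y => h (by_seed_code y))) => // y.
by rewrite -[X in measurable X]setTI; exact: (mf measurableT _ (measurable_code y)).
Qed.

(** * Revenue and utility *)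

Definition paid i z : R :=
  if accepts (before z i) i (time_of z i) (value_of z i) then prc (before z i) i else 0.

Definition utility i z : R := surplus i (before z i) (time_of z i) (value_of z i).

Definition gain i z : R :=
  if accepts (before z i) i (time_of z i) (value_of z i) then value_of z i else 0.

Lemma gainE i z : gain i z = discount (time_of z i) * paid i z + utility i z.
Proof.
rewrite /gain /paid /utility /surplus; case: ifP => _; last by rewrite mulr0 addr0.
by rewrite addrCA subrr addr0.
Qed.

Lemma paid_ge0 i z : 0 <= paid i z.
Proof. by rewrite /paid; case: ifP => // /and3P[iB _ _]; exact: price_ge0. Qed.

Lemma measurable_paid i : measurable_fun setT (paid i).
Proof.
apply: (@measurable_before _ _ i (fun A z =>
  if accepts A i (time_of z i) (value_of z i) then prc A i else 0)) => A.
apply: measurable_fun_ifT => //.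
by apply: measurable_accepts; [exact: measurable_time_of|exact: measurable_value_of].
Qed.

Lemma measurable_utility i : measurable_fun setT (utility i).
Proof.
apply: (@measurable_before _ _ i (fun A z => surplus i A (time_of z i) (value_of z i))) => A.
by apply: measurable_surplus; [exact: measurable_time_of|exact: measurable_value_of].
Qed.

Lemma measurable_gain i : measurable_fun setT (gain i).
Proof.
rewrite (_ : gain i = fun z => discount (time_of z i) * paid i z + utility i z); last first.
  by apply/funext => z; exact: gainE.
apply: measurable_funD; last exact: measurable_utility.
apply: measurable_funM; last exact: measurable_paid.
exact: (measurableT_comp measurable_discount (measurable_time_of i)).
Qed.

Lemma measurable_indicator_ler d (T : measurableType d) (f g : T -> R) :
  measurable_fun setT f -> measurable_fun setT g ->
  measurable_fun setT (fun w => (f w <= g w)%R%:R : R).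
Proof.
move=> mf mg; rewrite (_ : (fun _ => _) = fun w => if f w <= g w then 1 else 0 : R).
  by apply: measurable_fun_ifT => //; exact: measurable_fun_ler.
by apply/funext => w; case: ifP.
Qed.

(** The discount is replaced by a function of the seed with that mean, leaving undiscounted prices
    paid up to the seed, which telescope. *)
Definition revenue_at_seed i z : R :=
  time_weight (seed_of z) * (time_of z i <= seed_of z)%R%:R * paid i z.

Lemma revenue_at_seed_ge0 i z : 0 <= revenue_at_seed i z.
Proof. by rewrite !mulr_ge0 ?paid_ge0 // ltW // time_weight_gt0. Qed.

Lemma measurable_revenue_at_seed i : measurable_fun setT (revenue_at_seed i).
Proof.
apply: measurable_funM; last exact: measurable_paid.
apply: measurable_funM.
  exact: (measurableT_comp (@measurable_time_weight R) measurable_seed_of).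
by apply: measurable_indicator_ler; [exact: measurable_time_of|exact: measurable_seed_of].
Qed.

(* [discount r] is the expectation of [time_weight] on the event that the seed exceeds [r]. *)
Lemma integral_revenue i :
  (\int[Q]_z (discount (time_of z i) * paid i z)%R%:E = \int[Q]_z (revenue_at_seed i z)%:E)%E.
Proof.
(* Only the seed is redrawn; [paid i] does not read it and so is constant in the inner integral. *)
pose s (j : J) : (J + J)%type := if j is inl _ then inl j else inr j.
rewrite [RHS](mix_law Q_indep (s := s)); last 4 first.
- by move=> [a|[]] [b|[]] //= [->].
- by move=> [a|[]].
- by apply/measurable_EFinP; exact: measurable_revenue_at_seed.
- by move=> z; rewrite lee_fin revenue_at_seed_ge0.
apply: eq_integral => z _; apply/esym.
transitivity (\int[Q]_z' ((paid i z)%:E *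
    (time_weight (seed_of z') * (time_of z i <= seed_of z')%R%:R)%R%:E))%E.
  by apply: eq_integral => z' _; rewrite -EFinM mulrC.
have mh : measurable_fun setT (fun s : R => (time_weight s * (time_of z i <= s)%R%:R)%:E).
  apply/measurable_EFinP/measurable_funM; first exact: measurable_time_weight.
  exact: measurable_indicator_ler.
have h0 (u : R) : (0 <= (time_weight u * (time_of z i <= u)%R%:R)%:E)%E.
  by rewrite lee_fin mulr_ge0 // ltW // time_weight_gt0.
rewrite ge0_integralZl //; last 2 first.
- exact: (measurableT_comp mh measurable_seed_of).
- by rewrite lee_fin paid_ge0.
by rewrite (integral_seed mh h0) uniform_time_weight -EFinM mulrC.
Qed.

Lemma revenue_at_seed_sum z :
  \sum_i revenue_at_seed i z =
  time_weight (seed_of z) * (residual fset0 - residual (by_seed z)).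
Proof.
rewrite /by_seed selected_telescope.
- rewrite mulr_sumr [RHS]big_mkcond /=; apply: eq_bigr => i _.
  rewrite /revenue_at_seed; case: (time_of z i <= seed_of z); last by rewrite mulr0 mul0r.
  by rewrite mulr1.
- exact: arrives_le_total.
- exact: arrives_le_trans.
- exact: arrives_le_anti.
- by move=> i j /arrives_leW; exact: le_trans.
Qed.

Lemma by_seed_surplus_measurable i : measurable_fun setT
  (fun w : (E * E)%type => surplus i (by_seed w.1) (seed_of w.1) (value_of w.2 i)).
Proof.
apply: (@measurable_by_seed _ _ _ _ fst
  (fun A (w : (E * E)%type) => surplus i A (seed_of w.1) (value_of w.2 i))) => // A.
apply: measurable_surplus.
- exact: (measurableT_comp measurable_seed_of measurable_fst).
- exact: (measurableT_comp (measurable_value_of i) measurable_snd).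
Qed.

(** Moves [i] to the time of the seed and gives it a fresh value. The seed receives the old arrival
    time of [i], which keeps the map injective. *)
Let exchange i (j : J) : (J + J)%type :=
  match j with
  | inl (inl k) => if k == i then inr j else inl j
  | inl (inr k) => if k == i then inl (inr tt) else inl j
  | inr _ => inl (inl (inr i))
  end.

Let exchange_inj i : injective (exchange i).
Proof.
move=> [[a|a]|[]] [[b|b]|[]] //=.
- by case: (eqVneq a i) => [->|?]; case: (eqVneq b i) => [->|?] // [->].
- by case: (eqVneq a i) => [->|?]; case: (eqVneq b i).
- by case: (eqVneq a i).
- by case: (eqVneq a i) => [->|?]; case: (eqVneq b i).
- by case: (eqVneq a i) => [->|?]; case: (eqVneq b i) => [->|?] // [->].
- by case: (eqVneq a i) => // ai [e]; rewrite e eqxx in ai.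
- by case: (eqVneq b i).
- by case: (eqVneq b i) => // bi [e]; rewrite -e eqxx in bi.
Qed.

(** If [i] is in [by_seed z], the left side is 0. Otherwise [i], moved to the time of the seed,
    meets a subset of [by_seed z] by [selected_before_sub], and a smaller set offers more
    surplus. *)
Lemma utility_exchange i z z' :
  surplus i (by_seed z) (seed_of z) (value_of z' i) <= utility i (mix (exchange i) z z').
Proof.
set m := mix _ _ _.
have tmi : time_of m i = seed_of z by rewrite /time_of /m /mix /= eqxx.
have vmi : value_of m i = value_of z' i by rewrite /value_of /m /mix /= eqxx.
have tm j : j != i -> time_of m j = time_of z j.
  by move=> /negbTE ji; rewrite /time_of /m /mix /= ji.
have vm j : j != i -> value_of m j = value_of z j.
  by move=> /negbTE ji; rewrite /value_of /m /mix /= ji.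
have [iB|iB] := boolP (i \in by_seed z).
  by rewrite {1}/surplus /accepts iB /=; exact: surplus_ge0.
rewrite /utility tmi vmi; apply: surplus_mono; apply: selected_before_sub iB.
- exact: arrives_le_total.
- exact: arrives_le_trans.
- exact: arrives_le_anti.
- exact: arrives_le_total.
- exact: arrives_le_trans.
- exact: arrives_le_anti.
- by move=> j k ji ki; rewrite /arrives_le !tm.
- by move=> A j ji; rewrite tm // vm.
- by move=> j ji /arrives_leW; rewrite tmi tm.
Qed.

Lemma integral_utility i :
  (\int[Q]_z \int[Q]_z' (surplus i (by_seed z) (seed_of z) (value_of z' i))%:E
   <= \int[Q]_z (utility i z)%:E)%E.
Proof.
rewrite [leRHS](mix_law Q_indep (s := exchange i)); last 4 first.
- exact: exchange_inj.
(* The exchange preserves marginals because arrival times and the seed are all uniform on [0, 1]. *)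
- move=> [[k|k]|[]] A mA /=; try case: eqVneq => [->|_] //=.
    by rewrite (Q_seed mA) (Q_time _ mA).
  by rewrite (Q_seed mA) (Q_time _ mA).
- by apply/measurable_EFinP; exact: measurable_utility.
- by move=> z; rewrite lee_fin surplus_ge0.
have mS : measurable_fun setT (fun w : (E * E)%type =>
    (surplus i (by_seed w.1) (seed_of w.1) (value_of w.2 i))%:E).
  by apply/measurable_EFinP; exact: by_seed_surplus_measurable.
have mU : measurable_fun setT (fun w : (E * E)%type =>
    (utility i (mix (exchange i) w.1 w.2))%:E).
  apply/measurable_EFinP.
  exact: (measurableT_comp (measurable_utility i) (measurable_mix (exchange i))).
have S0 (w : (E * E)%type) :
    (0 <= (surplus i (by_seed w.1) (seed_of w.1) (value_of w.2 i))%:E)%E.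
  by rewrite lee_fin surplus_ge0.
have U0 (w : (E * E)%type) : (0 <= (utility i (mix (exchange i) w.1 w.2))%:E)%E.
  by rewrite lee_fin surplus_ge0.
apply: ge0_le_integral.
- exact: measurableT.
- by move=> z _; apply: integral_ge0 => z' _; exact: (S0 (z, z')).
- exact: (@measurable_fun_fubini_tonelli_F _ _ _ _ _ Q _ mS S0).
- exact: (@measurable_fun_fubini_tonelli_F _ _ _ _ _ Q _ mU U0).
move=> z _; apply: ge0_le_integral.
- exact: measurableT.
- by move=> z' _; exact: (S0 (z, z')).
- exact: (measurable_fun_pair2 z mS).
- exact: (measurable_fun_pair2 z mU).
- by move=> z' _; rewrite lee_fin utility_exchange.
Qed.

(** The mean of [surplus_sum] at a fixed set and time, with [time_weight s] written as
    [1 - discount s]. *)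
Lemma integral_surplus_sum A (s : R) :
  ((time_weight s * residual A)%:E <=
   \sum_i \int[Q]_z (surplus i A s (value_of z i))%:E)%E.
Proof.
have mS i : measurable_fun setT (fun z : E => (surplus i A s (value_of z i))%:E).
  apply/measurable_EFinP; apply: measurable_surplus => //.
  exact: measurable_value_of.
rewrite -ge0_integral_sum //; last by move=> i z _; rewrite lee_fin surplus_ge0.
have dR : 0 <= discount s * residual A by rewrite mulr_ge0 ?discount_ge0 ?residual_ge0.
have -> : time_weight s * residual A = residual A - discount s * residual A.
  by rewrite /discount; lra.
rewrite EFinB leeBlDr // -integral_contracted_opt.
have -> : (discount s * residual A)%:E = (\int[Q]_z (discount s * residual A)%:E)%E.
  rewrite integral_cst // [X in (_ * X)%E](_ : _ = 1%E) ?mule1 //.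
  exact: probability_setT.
rewrite -ge0_integralD //; last 2 first.
- by move=> z _; apply: sume_ge0 => i _; rewrite lee_fin surplus_ge0.
- exact: emeasurable_sum.
apply: ge0_le_integral => //.
- by move=> z _; rewrite lee_fin contracted_opt_ge0.
- by apply/measurable_EFinP; exact: measurable_contracted_opt.
- by apply: emeasurable_funD => //; exact: emeasurable_sum.
- by move=> z _; rewrite sumEFin -EFinD lee_fin surplus_sum.
Qed.

Lemma expected_gain :
  ((1 - expR (-1))%:E * (residual fset0)%:E <= \int[Q]_z (\sum_i gain i z)%:E)%E.
Proof.
have mW : measurable_fun setT (fun z => time_weight (seed_of z)).
  exact: (measurableT_comp (@measurable_time_weight R) measurable_seed_of).
have mD i : measurable_fun setT (fun z => discount (time_of z i) * paid i z).
  apply: measurable_funM; last exact: measurable_paid.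
  exact: (measurableT_comp measurable_discount (measurable_time_of i)).
have mB : measurable_fun setT (fun z => residual (by_seed z)).
  exact: (@measurable_by_seed _ _ _ _ id (fun A _ => residual A)).
(* The values in the inner integral are independent of [by_seed z], so [integral_surplus_sum]
   applies for each fixed [z]. *)
have util_ge : (\int[Q]_z (time_weight (seed_of z) * residual (by_seed z))%:E
    <= \sum_i \int[Q]_z (utility i z)%:E)%E.
  apply: (@le_trans _ _ (\sum_i \int[Q]_z \int[Q]_z'
    (surplus i (by_seed z) (seed_of z) (value_of z' i))%:E)%E); last first.
    by apply: lee_sum => i _; exact: integral_utility.
  have mF i : measurable_fun setT (fun z =>
      \int[Q]_z' (surplus i (by_seed z) (seed_of z) (value_of z' i))%:E)%E.
    apply: (@measurable_fun_fubini_tonelli_F _ _ _ _ _ Q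
      (fun w => (surplus i (by_seed w.1) (seed_of w.1) (value_of w.2 i))%:E)).
    + by apply/measurable_EFinP; exact: by_seed_surplus_measurable.
    + by move=> w; rewrite lee_fin surplus_ge0.
  rewrite -ge0_integral_sum //; last first.
    by move=> i z _; apply: integral_ge0 => z' _; rewrite lee_fin surplus_ge0.
  apply: ge0_le_integral => //.
  - by move=> z _; rewrite lee_fin mulr_ge0 ?residual_ge0 // ltW // time_weight_gt0.
  - by apply/measurable_EFinP; exact: measurable_funM.
  - exact: emeasurable_sum.
  - by move=> z _; exact: integral_surplus_sum.
have -> : (\int[Q]_z (\sum_i gain i z)%:E = \sum_i \int[Q]_z (revenue_at_seed i z)%:E +
    \sum_i \int[Q]_z (utility i z)%:E)%E.
  under eq_integral do rewrite -sumEFin.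
  rewrite ge0_integral_sum //; last 2 first.
  - by move=> i; apply/measurable_EFinP; exact: measurable_gain.
  - move=> i z _; rewrite lee_fin gainE addr_ge0 ?surplus_ge0 //.
    by rewrite mulr_ge0 ?discount_ge0 ?paid_ge0.
  rewrite -big_split /=; apply: eq_bigr => i _; rewrite -integral_revenue.
  rewrite -ge0_integralD //.
  - by apply: eq_integral => z _; rewrite gainE EFinD.
  - by move=> z _; rewrite lee_fin mulr_ge0 ?discount_ge0 ?paid_ge0.
  - exact/measurable_EFinP.
  - by move=> z _; rewrite lee_fin surplus_ge0.
  - by apply/measurable_EFinP; exact: measurable_utility.
apply: le_trans (leeD (lexx _) util_ge).
have mWB : measurable_fun setT (fun z => time_weight (seed_of z) * residual (by_seed z)).
  exact: measurable_funM.
rewrite -ge0_integral_sum //; last 2 first.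
- by move=> i; apply/measurable_EFinP; exact: measurable_revenue_at_seed.
- by move=> i z _; rewrite lee_fin revenue_at_seed_ge0.
rewrite -ge0_integralD //; last 4 first.
- by move=> z _; apply: sume_ge0 => i _; rewrite lee_fin revenue_at_seed_ge0.
- by apply: emeasurable_sum => i; apply/measurable_EFinP; exact: measurable_revenue_at_seed.
- by move=> z _; rewrite lee_fin mulr_ge0 ?residual_ge0 // ltW // time_weight_gt0.
- exact/measurable_EFinP.
have mh : measurable_fun setT (fun s : R => (time_weight s * (0 <= s)%R%:R)%:E).
  apply/measurable_EFinP/measurable_funM; first exact: measurable_time_weight.
  exact: measurable_indicator_ler.
have h0 (u : R) : (0 <= (time_weight u * (0 <= u)%R%:R)%:E)%E.
  by rewrite lee_fin mulr_ge0 // ltW // time_weight_gt0.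
(* The constant is the mean of [time_weight] at the seed: [uniform_time_weight] with [r = 0]. *)
have -> : (1 - expR (-1))%:E =
    (\int[Q]_z (time_weight (seed_of z) * (0 <= seed_of z)%R%:R)%R%:E)%E.
  rewrite (integral_seed mh h0) uniform_time_weight /time_weight maxxx.
  by rewrite (min_idPl ler01) sub0r.
have mhs := measurableT_comp mh measurable_seed_of.
rewrite -ge0_integralZr //; last by rewrite lee_fin residual_ge0.
apply: ge0_le_integral => //.
- by move=> z _; rewrite mule_ge0 // lee_fin residual_ge0.
- by apply: emeasurable_funM.
- apply: emeasurable_funD; last exact/measurable_EFinP.
  by apply: emeasurable_sum => i; apply/measurable_EFinP; exact: measurable_revenue_at_seed.
(* The terms in [residual (by_seed z)] cancel pointwise, leaving
   [time_weight (seed_of z) * residual fset0]; the indicator is at most 1. *)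
move=> z _; rewrite sumEFin revenue_at_seed_sum -EFinD -EFinM lee_fin.
rewrite -mulrDr subrK ler_wpM2r ?residual_ge0 // ler_piMr //.
  by rewrite ltW // time_weight_gt0.
by case: (0 <= _).
Qed.

Lemma alg_value_gain z :
  alg_value M (set_alg accepts) (time_of z) (value_of z) (seed_of z) = \sum_i gain i z.
Proof.
rewrite /alg_value selected_set_alg; last by move=> A i t x /and3P[].
rewrite big_mkcond; apply: eq_bigr => i _.
rewrite mem_greedy_order //.
- exact: arrives_le_total.
- exact: arrives_le_trans.
- exact: arrives_le_anti.
Qed.

End threshold_algorithm.

(** * Existence *)

Section single_element.
Variables (R : realType) (n : nat) (M : matroid n) (i : 'I_n).
Hypothesis indep_i : indep M (finset.set1 i).

(** The rule for an infinite expected optimum: it waits for one buyer of infinite mean. The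
    threshold 0 makes its value the positive part. *)
Definition accepts_only (A : {set 'I_n}) (j : 'I_n) (t x : R) : bool :=
  [&& j == i, indep M (j |: A) & 0 <= x].

Lemma alg_value_single (t x : 'I_n -> R) (u : R) :
  alg_value M (set_alg accepts_only) t x u = Num.max (x i) 0.
Proof.
rewrite /alg_value selected_set_alg; last by move=> A j s y /and3P[].
pose acc (A : {set 'I_n}) j := accepts_only A j (t j) (x j).
have sel l : greedy acc fset0 l =
    if (i \in l) && (0 <= x i) then finset.set1 i else fset0.
  elim/last_ind: l => [//|l e IH]; rewrite -cats1 greedy_cat IH /= mem_cat inE.
  rewrite /acc /accepts_only (eq_sym i e); case: (eqVneq e i) => [->|_] /=; last first.
    by rewrite orbF.
  rewrite orbT /=; case: (leP 0 (x i)) => _; rewrite ?andbT ?andbF //=.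
  by case: (i \in l); rewrite ?finset.setUid ?finset.setU0 indep_i.
rewrite -/acc sel mem_sort mem_enum /=; case: (leP 0 (x i)) => _.
  by rewrite finset.big_set1.
by rewrite finset.big_set0.
Qed.

End single_element.

Section existence.
Variables (R : realType) (n : nat) (M : matroid n).

Local Notation J := (('I_n + 'I_n) + unit)%type.
Local Notation E := (sample_space R J).

(** This bound reduces an infinite expected optimum to a single buyer with infinite mean positive
    part. *)
Lemma opt_value_le_sum (x : 'I_n -> R) :
  opt_value M x <= \sum_(i | indep M (finset.set1 i)) Num.max (x i) 0.
Proof.
rewrite /opt_value; apply: bigmax_le => [|S iS].
  by apply: sumr_ge0 => i _; rewrite le_max lexx orbT.
apply: (@le_trans _ _ (\sum_(i in S) Num.max (x i) 0)).
  by apply: ler_sum => i _; rewrite le_max lexx.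
rewrite [leRHS](bigID (fun i => i \in S)) /=.
rewrite [X in _ <= X + _](eq_bigl (fun i => i \in S)) => [|i]; last first.
  case: (boolP (i \in S)) => [inS|_]; last by rewrite andbF.
  by rewrite andbT; apply: indep_sub iS; rewrite finset.sub1set.
by rewrite lerDl; apply: sumr_ge0 => i _; rewrite le_max lexx orbT.
Qed.

(** Measurability and sign of [W] are exported so that the inequality can be carried to other models
    by [ge0_integral_law]. *)
Lemma exists_good_alg (Q : probability E R) :
  (forall B, (forall j, measurable (B j)) ->
    Q (box B) = (\prod_j Q ((fun z : E => z j) @^-1` (B j)))%E) ->
  (forall i A, measurable A ->
    Q ((fun z : E => time_of z i) @^-1` A) = lebesgue_measure (A `&` `[0, 1])) ->
  (forall A, measurable A ->
    Q (@seed_of R n @^-1` A) = lebesgue_measure (A `&` `[0, 1])) ->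
  exists alg : online_alg R n,
    let W (z : E) := alg_value M alg (time_of z) (value_of z) (seed_of z) in
    [/\ measurable_fun setT W, forall z, 0 <= W z
      & ((1 - expR (-1))%:E * \int[Q]_z (opt_value M (value_of z))%:E
         <= \int[Q]_z (W z)%:E)%E].
Proof.
move=> Q_indep Q_time Q_seed.
have mopt : measurable_fun setT (fun z : E => opt_value M (value_of z)).
  under eq_fun do rewrite -contracted_opt0; exact: measurable_contracted_opt.
have mmax i : measurable_fun setT (fun z : E => Num.max (value_of z i) 0).
  by apply: measurable_maxr => //; exact: measurable_value_of.
have [fin|inf] := ltP (\int[Q]_z (opt_value M (value_of z))%:E)%E +oo%E.
  exists (set_alg (accepts M Q)); split.
  - under eq_fun do rewrite alg_value_gain.
    by apply: measurable_sum => i; exact: measurable_gain.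
  - move=> z; rewrite alg_value_gain; apply: sumr_ge0 => i _.
    rewrite gainE addr_ge0 ?surplus_ge0 // mulr_ge0 ?discount_ge0 //.
    exact: (paid_ge0 fin).
  - under [X in (_ <= X)%E]eq_integral do rewrite alg_value_gain.
    under [X in (_ * X <= _)%E]eq_integral do rewrite -contracted_opt0.
    rewrite (integral_contracted_opt fin).
    exact: expected_gain.
(* Were all these means finite, so would be the finite sum that bounds the optimum. *)
have [i [indi infi]] : exists i, indep M (finset.set1 i) /\
    (\int[Q]_z (Num.max (value_of z i) 0)%:E = +oo)%E.
  apply: contrapT => no; move: inf; apply/negP; rewrite -ltNge.
  apply: (@le_lt_trans _ _ (\int[Q]_z
    (\sum_(i <- enum 'I_n | indep M (finset.set1 i)) (Num.max (value_of z i) 0)%:E))%E).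
    apply: ge0_le_integral => //.
    - by move=> z _; rewrite lee_fin -contracted_opt0 contracted_opt_ge0.
    - exact/measurable_EFinP.
    - under eq_fun do rewrite big_mkcond /=.
      apply: emeasurable_sum => i; case: (indep M _) => //.
      exact/measurable_EFinP.
    - by move=> z _; rewrite sumEFin lee_fin big_enum_cond /=; exact: opt_value_le_sum.
  under eq_integral do rewrite -big_filter.
  rewrite ge0_integral_sum //; last 2 first.
  - by move=> i; exact/measurable_EFinP.
  - by move=> i z _; rewrite lee_fin le_max lexx orbT.
  rewrite big_filter; apply: lte_sum_pinfty => i ii.
  by rewrite ltey; apply/eqP => infi; apply: no; exists i.
exists (set_alg (accepts_only M i)); split.
- by under eq_fun do rewrite (alg_value_single indi); exact: mmax.
- by move=> z; rewrite alg_value_single // le_max lexx orbT.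
- under [X in (_ <= X)%E]eq_integral do rewrite alg_value_single //.
  by rewrite infi leey.
Qed.

End existence.

Definition prophet_model (R : realType) (n : nat) (mu : 'I_n -> probability R R)
    (d : measure_display) (Omega : measurableType d) (P : probability Omega R)
    (v T : 'I_n -> Omega -> R) (xi : Omega -> R) : Prop :=
  [/\ (forall i, measurable_fun setT (v i)) /\ (forall i, measurable_fun setT (T i)) /\
        measurable_fun setT xi,
      forall i A, measurable A -> P (v i @^-1` A) = mu i A,
      forall i A, measurable A -> P (T i @^-1` A) = lebesgue_measure (A `&` `[0, 1]),
      forall A, measurable A -> P (xi @^-1` A) = lebesgue_measure (A `&` `[0, 1])
    & mutually_independent P (all_rvs v T xi)].

(** * The joint law of a model *)

Section model.
Variables (R : realType) (n : nat) (mu : 'I_n -> probability R R).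
Variables (d : measure_display) (Omega : measurableType d) (P : probability Omega R).
Variables (v T : 'I_n -> Omega -> R) (xi : Omega -> R).
Hypothesis model : prophet_model mu P v T xi.

Local Notation J := (('I_n + 'I_n) + unit)%type.

Definition joint (w : Omega) : sample_space R J := fun j => all_rvs v T xi j w.

Lemma measurable_joint : measurable_fun setT joint.
Proof.
case: model => -[mv [mT mxi]] _ _ _ _; apply: measurable_to_sample => -[[i|i]|[]].
- exact: mv.
- exact: mT.
- exact: mxi.
Qed.

Lemma joint_preimage_box (B : J -> set R) :
  joint @^-1` box B = \bigcap_(j in [set: J]) (all_rvs v T xi j @^-1` B j).
Proof. by apply/seteqP; split=> [w H j _|w H j]; [exact: H|exact: (H j)]. Qed.

(** The right side mentions only [mu], so any two models have the same joint law on boxes. *)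
Lemma joint_box (B : J -> set R) : (forall j, measurable (B j)) ->
  P (joint @^-1` box B) =
  (\prod_(j : J) (match j with
     | inl (inl i) => mu i (B j)
     | _ => lebesgue_measure (B j `&` `[0%R, 1%R])
     end))%E.
Proof.
case: model => _ lv lT lxi ind mB.
rewrite joint_preimage_box ind //; apply: eq_bigr => -[[i|i]|[]] _ /=.
- exact: lv.
- exact: lT.
- exact: lxi.
Qed.

Lemma joint_distribution : exists Q : probability (sample_space R J) R,
  forall A, Q A = P (joint @^-1` A).
Proof.
pose X : {mfun Omega >-> sample_space R J} :=
  HB.pack joint (isMeasurableFun.Build _ _ _ _ _ measurable_joint).
by exists (distribution P X).
Qed.

End model.

Theorem theorem1 (R : realType) (n : nat) (M : matroid n)
    (mu : 'I_n -> probability R R)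
    (mu_nonneg : forall i, mu i `]-oo, 0[%classic = 0%E) :
  exists alg : online_alg R n,
  forall (d : measure_display) (Omega : measurableType d) (P : probability Omega R)
    (v T : 'I_n -> Omega -> R) (xi : Omega -> R),
    (forall i, measurable_fun setT (v i)) ->
    (forall i, measurable_fun setT (T i)) ->
    measurable_fun setT xi ->
    (forall i A, measurable A -> P (v i @^-1` A) = mu i A) ->
    (forall i A, measurable A -> P (T i @^-1` A) = lebesgue_measure (A `&` `[0, 1]%classic)) ->
    (forall A, measurable A -> P (xi @^-1` A) = lebesgue_measure (A `&` `[0, 1]%classic)) ->
    mutually_independent P (all_rvs v T xi) ->
    (((1 - expR (-1)) : R)%:E *
       \int[P]_w (opt_value M (fun i => v i w))%:E
     <= \int[P]_w (alg_value M alg (fun i => T i w) (fun i => v i w) (xi w))%:E)%E.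
Proof.
(* The algorithm may depend only on [mu]: its residual values are computed in an
   arbitrary model, since all models have the same joint law. *)
have [has_model|no_model] := pselect
  (exists d (Omega : measurableType d) (P : probability Omega R) v T xi,
    prophet_model mu P v T xi); last first.
  (* Without a model for [mu] the claim is vacuous. *)
  exists (fun _ _ _ _ _ => false) => d Omega P v T xi mv mT mxi lv lT lxi ind.
  by exfalso; apply: no_model; exists d, Omega, P, v, T, xi.
have [d0 [S0 [P0 [v0 [T0 [xi0 model0]]]]]] := has_model.
have [Q QE] := joint_distribution model0.
have [] := @exists_good_alg R n M Q.
- move=> B mB; rewrite QE joint_preimage_box.
  case: model0 => _ _ _ _ ind0; rewrite ind0 //.
  by apply: eq_bigr => j _; rewrite QE.
- by case: model0 => _ _ lT0 _ _ i A mA; rewrite QE; exact: lT0.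
- by case: model0 => _ _ _ lxi0 _ A mA; rewrite QE; exact: lxi0.
move=> alg [mW W0 good]; exists alg => d Omega P v T xi mv mT mxi lv lT lxi ind.
have model : prophet_model mu P v T xi by [].
(* By [joint_box] for both models, the joint law under [P] is [Q]; both sides of the bound are
   integrals of functions of the joint sample. *)
have transfer (f : sample_space R (('I_n + 'I_n) + unit)%type -> R) :
    measurable_fun setT f -> (forall z, 0 <= f z) ->
    (\int[P]_w (f (joint v T xi w))%:E = \int[Q]_z (f z)%:E)%E.
  move=> mf f0; apply: (@ge0_integral_law _ _ _ _ _ _ P Q _ id (fun z => (f z)%:E)) => //.
  - exact: (le_lt_trans (probability_le1 P measurableT) (ltry _)).
  - exact: (measurable_joint model).
  - move=> B mB; apply: (etrans (joint_box model mB)).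
    by apply: (etrans (esym (joint_box model0 mB))); rewrite -QE.
  - exact/measurable_EFinP.
have := good; rewrite -(transfer _ mW W0) -(transfer (fun z => opt_value M (value_of z))) //.
- under eq_fun do rewrite -contracted_opt0; exact: measurable_contracted_opt.
- by move=> z; rewrite -contracted_opt0 contracted_opt_ge0.
Qed.
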